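(* Suppose that $\nu$ is an algebraic discrete valuation dominating a local domain $(R,\mathfrak{m}_R)$, and that the residue field $V_{\nu}/\mathfrak{m}_{\nu}$ is a finite extension of $R/\mathfrak{m}_R$. Then there exist $c,b \in \mathbb{Z}$ such that $$\ell_R(R/I_n)=cn+b$$ for all sufficiently large integers $n$, where $c=|V_{\nu}/\mathfrak{m}_{\nu}:R/\mathfrak{m}_R|$ is the degree of the residue field extension.
   Context: Local rings are Noetherian. Let $K$ be the quotient field of the local domain $(R,\mathfrak{m}_R)$. For a valuation $\nu$ of $K$, $V_{\nu}=\{f\in K\mid \nu(f)\ge 0\}$ is its valuation ring, with maximal ideal $\mathfrak{m}_{\nu}=\{f\in K\mid \nu(f)>0\}$. The valuation $\nu$ dominates $R$ if $R\subset V_{\nu}$ and $R\cap \mathfrak{m}_{\nu}=\mathfrak{m}_R$. It is discrete if its value group is order isomorphic to $\mathbb{Z}$ (and the value group is then identified with $\mathbb{Z}$). A discrete valuation dominating $R$ is algebraic if the residue field extension $V_{\nu}/\mathfrak{m}_{\nu}$ of $R/\mathfrak{m}_R$ is algebraic. For $n\in\mathbb{Z}_{\ge 0}$, $I_n=\{f\in R\mid \nu(f)\ge n\}$. $\ell_R$ denotes length as an $R$-module. *)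

(* Defs.v *)
From HB Require Import structures.
From mathcomp Require Import all_boot all_order all_algebra.
From mathcomp Require Import generic_quotient ring_quotient fraction.
From mathcomp Require Import boolp constructive_ereal.

Set Implicit Arguments.
Unset Strict Implicit.
Unset Printing Implicit Defensive.

Import Order.TTheory GRing.Theory Num.Theory.

Local Open Scope ring_scope.
Local Open Scope quotient_scope.

Notation "x %:F" := (@FracField.tofrac _ x) : ring_scope.

(* Ideals and submodules are boolean predicates, as in ring_quotient and
   ssralg.  Classically (asbool) these are arbitrary subsets. *)

Section Rings.
Variable R : comNzRingType.

(* idealr_closed includes properness, so [predT] is treated separately
   (it is generated by 1). *)
Definition noetherian := forall I : {pred R}, idealr_closed I ->
  exists s : seq R, all [in I] s /\
    forall x, x \in I -> exists a : 'I_(size s) -> R,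
      x = \sum_(i < size s) a i * s`_i.

Definition maximal_ideal (I : {pred R}) :=
  idealr_closed I /\
  forall J : {pred R}, idealr_closed J -> {subset I <= J} -> J =i I.

End Rings.

Record localDomain := LocalDomain {
  local_ring :> idomainType;
  maxideal : {pred local_ring};
  local_noetherian : noetherian local_ring;
  maxideal_maximal : maximal_ideal maxideal;
  maxideal_unique : forall J : {pred local_ring},
    maximal_ideal J -> J =i maxideal }.

HB.instance Definition _ (R : localDomain) :=
  isIdealr.Build R (@maxideal R) (proj1 (maxideal_maximal R)).

Section ResidueField.
Variable R : localDomain.

Definition residue : Type := {ideal_quot (@maxideal R)}.
HB.instance Definition _ := GRing.ComNzRing.on residue.

Lemma residue_inv_ex (x : residue) : x != 0 -> exists y, y * x == 1.
Proof.
have [mcl mmax] := maxideal_maximal R; have [m0 m1 mD] := mcl.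
elim/quotW: x => a; rewrite piE /Quotient.equiv subr0 => aNm.
pose J : {pred R} := fun z => `[< exists b, z - b * a \in @maxideal R >].
have sub : {subset @maxideal R <= J}.
  by move=> z zm; apply/asboolP; exists 0; rewrite mul0r subr0.
have Ja : a \in J by apply/asboolP; exists 1; rewrite mul1r subrr.
have [/asboolP[b hb]|J1] := boolP (1 \in J).
  exists (\pi_residue b); rewrite -rmorphM -(rmorph1 \pi_residue).
  rewrite eq_sym piE /Quotient.equiv.
  exact: hb.
case/negP: aNm; rewrite -(mmax J) //; split=> //; first exact: sub.
move=> c u w /asboolP[b hb] /asboolP[b' hb']; apply/asboolP.
exists (c * b + b'); have -> : c * u + w - (c * b + b') * a =
  c * (u - b * a) + (w - b' * a).
  by rewrite mulrBr mulrDl mulrA opprD addrACA.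
exact: mD.
Qed.

Lemma residue_inv_spec (x : residue) :
  exists y, if x == 0 then y == 0 else y * x == 1.
Proof.
by have [_|/residue_inv_ex//] := eqVneq x 0; exists 0.
Qed.

Definition residue_inv (x : residue) : residue := xchoose (residue_inv_spec x).

Lemma residue_mulV (x : residue) : x != 0 -> residue_inv x * x = 1.
Proof.
move/negPf=> x0; have : if x == 0 then residue_inv x == 0 else residue_inv x * x == 1.
  exact: (xchooseP (residue_inv_spec x)).
by rewrite x0 => /eqP.
Qed.

Lemma residue_inv0 : residue_inv 0 = 0.
Proof.
have : if 0 == 0 :> residue then residue_inv 0 == 0 else residue_inv 0 * 0 == 1.
  exact: (xchooseP (residue_inv_spec 0)).
by rewrite eqxx => /eqP.
Qed.

HB.instance Definition _ :=
  GRing.ComNzRing_isField.Build residue residue_mulV residue_inv0.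

End ResidueField.

(* The value group is identified with int; +oo is the value at 0, and -oo
   is excluded by dvalM and dval_surj, which force dval 1 = 0. *)
Record discreteValuation (K : fieldType) := DiscreteValuation {
  dval :> K -> \bar int;
  dval_eqy : forall x, dval x = +oo%E <-> x = 0;
  dvalM : forall x y, dval (x * y) = (dval x + dval y)%E;
  dvalD : forall x y, (Order.min (dval x) (dval y) <= dval (x + y))%E;
  dval_surj : forall n : int, exists x, dval x = n%:E }.

Section ValuationRing.
Variables (K : fieldType) (v : discreteValuation K).

Lemma dval0 : v 0 = +oo%E. Proof. exact/dval_eqy. Qed.

Lemma dval1 : v 1 = 0%E.
Proof.
have [x vx] := dval_surj v 0; have := dvalM v x 1.
by rewrite mulr1 vx add0e.
Qed.

Lemma dvalN1 : v (- 1) = 0%E.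
Proof.
have := dvalM v (-1) (-1); rewrite mulrNN mulr1 dval1.
case: (v (-1)) => [r| |] //= /eqP; rewrite -EFinD eqe => /eqP h.
congr EFin; move/eqP: h; rewrite -mulr2n eq_sym mulrn_eq0 /=.
by move/eqP.
Qed.

Lemma dvalN x : v (- x) = v x.
Proof. by rewrite -mulN1r dvalM dvalN1 add0e. Qed.

Definition valring_pred : {pred K} := fun f => (0 <= v f)%E.

Lemma valring_subring : subring_closed valring_pred.
Proof.
split=> [|x y|x y]; rewrite !unfold_in /valring_pred ?dval1 // => xV yV.
- by apply: le_trans (dvalD v _ _); rewrite le_min dvalN xV yV.
- by rewrite dvalM adde_ge0.
Qed.
HB.instance Definition _ :=
  GRing.isSubringClosed.Build K valring_pred valring_subring.

Record valring := Valring {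
  valring_val :> K; valring_valP : valring_val \in valring_pred }.
HB.instance Definition _ := [isSub for valring_val].
HB.instance Definition _ := [Choice of valring by <:].
HB.instance Definition _ := [SubChoice_isSubComNzRing of valring by <:].

Definition valmax : {pred valring} := fun f => (0 < v (val f))%E.

Lemma valmax_ideal : idealr_closed valmax.
Proof.
split=> [||a x y]; rewrite !unfold_in /valmax.
- by rewrite raddf0 dval0.
- by rewrite rmorph1 dval1 ltxx.
- move=> xm ym; rewrite rmorphD.
  apply: lt_le_trans (dvalD v _ _); rewrite lt_min ym andbT rmorphM dvalM.
  by apply: lt_le_trans xm _; rewrite leeDr //; exact: (valP a).
Qed.
HB.instance Definition _ := isIdealr.Build valring valmax valmax_ideal.

Lemma valring_inv_ex (x : {ideal_quot valmax}) : x != 0 -> exists y, y * x == 1.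
Proof.
elim/quotW: x => f; rewrite piE /Quotient.equiv subr0.
rewrite unfold_in /valmax -leNgt => vf_le0.
have vf0 : v (val f) = 0%E by apply/eqP; rewrite eq_le vf_le0; exact: (valP f).
have fN0 : val f != 0 by apply/eqP => /(dval_eqy v); rewrite vf0.
have fVV : (val f)^-1 \in valring_pred.
  rewrite unfold_in /valring_pred; have := dvalM v (val f)^-1 (val f).
  by rewrite mulVf // dval1 vf0 adde0 => <-.
exists (\pi_{ideal_quot valmax} (Valring fVV)); rewrite -rmorphM.
suff -> : Valring fVV * f = 1 by rewrite rmorph1.
by apply: val_inj; rewrite rmorphM rmorph1 /= mulVf.
Qed.

End ValuationRing.

Arguments valmax {K} v.
Arguments valring_pred {K} v.

Record dominatingValuation (R : localDomain) := DominatingValuation {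
  dominating_val :> discreteValuation {fraction R};
  dominating_sub : forall f : R, f%:F \in valring_pred dominating_val;
  dominating_max : forall f : R,
    (f \in @maxideal R) = (0 < dominating_val f%:F)%E }.

Section Dominating.
Variables (R : localDomain) (v : dominatingValuation R).

Definition vresidue : Type := {ideal_quot (valmax v)}.
HB.instance Definition _ := GRing.ComNzRing.on vresidue.

Lemma vresidue_inv_spec (x : vresidue) :
  exists y, if x == 0 then y == 0 else y * x == 1.
Proof.
by have [_|/valring_inv_ex//] := eqVneq x 0; exists 0.
Qed.

Definition vresidue_inv (x : vresidue) : vresidue := xchoose (vresidue_inv_spec x).

Lemma vresidue_mulV (x : vresidue) : x != 0 -> vresidue_inv x * x = 1.
Proof.
move/negPf=> x0; have : if x == 0 then vresidue_inv x == 0 else vresidue_inv x * x == 1.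
  exact: (xchooseP (vresidue_inv_spec x)).
by rewrite x0 => /eqP.
Qed.

Lemma vresidue_inv0 : vresidue_inv 0 = 0.
Proof.
have : if 0 == 0 :> vresidue then vresidue_inv 0 == 0 else vresidue_inv 0 * 0 == 1.
  exact: (xchooseP (vresidue_inv_spec 0)).
by rewrite eqxx => /eqP.
Qed.

HB.instance Definition _ :=
  GRing.ComNzRing_isField.Build vresidue vresidue_mulV vresidue_inv0.

Definition to_valring (f : R) : valring v := Valring (dominating_sub v f).

(* The embedding of residue fields induced by the inclusion of R in V. *)
Definition resmap (x : residue R) : vresidue :=
  \pi_vresidue (to_valring (repr x)).

Lemma resmap_pi f : resmap (\pi_(residue R) f) = \pi_vresidue (to_valring f).
Proof.
apply/eqP; rewrite /resmap piE /Quotient.equiv.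
have : repr (\pi_(residue R) f) - f \in @maxideal R.
  by rewrite Quotient.idealrBE reprK.
by rewrite (dominating_max v) rmorphB.
Qed.

Lemma resmap_is_zmod_morphism : zmod_morphism resmap.
Proof.
move=> x y; rewrite -[x]reprK -[y]reprK -rmorphB !resmap_pi -rmorphB.
by congr \pi; apply: val_inj; rewrite /= !rmorphB.
Qed.
HB.instance Definition _ := GRing.isZmodMorphism.Build (residue R) vresidue
  resmap resmap_is_zmod_morphism.

Lemma resmap_is_monoid_morphism : monoid_morphism resmap.
Proof.
split=> [|x y].
  rewrite -(rmorph1 \pi_(residue R)) resmap_pi -(rmorph1 \pi_vresidue).
  by congr \pi; apply: val_inj; rewrite /= !rmorph1.
rewrite -[x]reprK -[y]reprK -rmorphM !resmap_pi -rmorphM.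
by congr \pi; apply: val_inj; rewrite /= !rmorphM.
Qed.
HB.instance Definition _ := GRing.isMonoidMorphism.Build (residue R) vresidue
  resmap resmap_is_monoid_morphism.

Definition vresidue_scale (a : residue R) (x : vresidue) : vresidue :=
  resmap a * x.

Lemma vresidue_scaleA a b x :
  vresidue_scale a (vresidue_scale b x) = vresidue_scale (a * b) x.
Proof. by rewrite /vresidue_scale rmorphM mulrA. Qed.
Lemma vresidue_scale1 : left_id 1 vresidue_scale.
Proof. by move=> x; rewrite /vresidue_scale rmorph1 mul1r. Qed.
Lemma vresidue_scaleDr : right_distributive vresidue_scale +%R.
Proof. by move=> a x y; rewrite /vresidue_scale mulrDr. Qed.
Lemma vresidue_scaleDl x :
  {morph vresidue_scale^~ x : a b / a + b}.
Proof. by move=> a b; rewrite /vresidue_scale rmorphD mulrDl. Qed.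

HB.instance Definition _ :=
  GRing.Zmodule_isLmodule.Build (residue R) vresidue
    vresidue_scaleA vresidue_scale1 vresidue_scaleDr vresidue_scaleDl.

Definition algebraic_valuation :=
  forall x : vresidue, algebraicOver resmap x.

(* [Vector.axiom d] is the data of a linear isomorphism with 'rV_d: the
   residue field extension is finite of degree d. *)
Definition residue_degree (d : nat) := inhabited (Vector.axiom d vresidue).

Definition valideal (n : nat) : {pred R^o} :=
  fun f : R => (n%:Z%:E <= v f%:F)%E.

Lemma valideal_submod n : submod_closed (valideal n).
Proof.
split=> [|a x y]; rewrite !unfold_in /valideal; first by rewrite rmorph0 dval0 leey.
move=> xI yI.
rewrite rmorphD; apply: le_trans (dvalD v _ _); rewrite le_min yI andbT.
have -> : a *: x = (a : R) * (x : R) by [].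
rewrite rmorphM dvalM; apply: le_trans xI _.
by rewrite leeDr //; exact: (dominating_sub v a).
Qed.
HB.instance Definition _ n :=
  GRing.isSubmodClosed.Build R R^o (valideal n) (valideal_submod n).

End Dominating.

Section QuotientModule.
Variables (R : comNzRingType) (M : lmodType R) (N : submodClosed M).

Definition submod_pred : {pred M} := N.

Lemma submod_pred_zmod : zmod_closed submod_pred.
Proof. exact: (GRing.submod_closedB (submodClosedP N)). Qed.
HB.instance Definition _ :=
  GRing.isZmodClosed.Build M submod_pred submod_pred_zmod.

Definition modquot : Type := {ideal_quot submod_pred}.
HB.instance Definition _ := GRing.Zmodule.on modquot.
HB.instance Definition _ := EqQuotient.on modquot.

Definition modquot_scale (a : R) (x : modquot) : modquot :=
  \pi_modquot (a *: repr x).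

Lemma modquot_scale_pi a (x : M) :
  modquot_scale a (\pi_modquot x) = \pi_modquot (a *: x).
Proof.
apply/eqP; rewrite /modquot_scale piE /Quotient.equiv -scalerBr.
have : repr (\pi_modquot x) - x \in submod_pred.
  by rewrite Quotient.idealrBE reprK.
exact: (@rpredZ _ _ N).
Qed.

Lemma modquot_scaleA a b x :
  modquot_scale a (modquot_scale b x) = modquot_scale (a * b) x.
Proof.
elim/quotW: x => x.
by rewrite (modquot_scale_pi b) (modquot_scale_pi a) modquot_scale_pi scalerA.
Qed.
Lemma modquot_scale1 : left_id 1 modquot_scale.
Proof. by elim/quotW=> x; rewrite modquot_scale_pi scale1r. Qed.
Lemma modquot_scaleDr : right_distributive modquot_scale +%R.
Proof.
move=> a; elim/quotW=> x; elim/quotW=> y.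
by rewrite !modquot_scale_pi -!raddfD /= modquot_scale_pi scalerDr.
Qed.
Lemma modquot_scaleDl x : {morph modquot_scale^~ x : a b / a + b}.
Proof.
by move=> a b; elim/quotW: x => x; rewrite !modquot_scale_pi -raddfD scalerDl.
Qed.

HB.instance Definition _ :=
  GRing.Zmodule_isLmodule.Build R modquot
    modquot_scaleA modquot_scale1 modquot_scaleDr modquot_scaleDl.

End QuotientModule.

Section Length.
Variables (R : comNzRingType) (M : lmodType R).

Definition submodule_chain (l : nat) (C : nat -> {pred M}) :=
  (forall i, (i <= l)%N -> submod_closed (C i)) /\
  (forall i, (i < l)%N -> {subset C i <= C i.+1} /\
     exists2 x, x \in C i.+1 & x \notin C i).

(* The length of M is finite and equal to l: l is the largest length of a
   strictly increasing chain of submodules. *)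
Definition has_length (l : nat) :=
  (exists C, submodule_chain l C) /\
  (forall k C, submodule_chain k C -> (k <= l)%N).

End Length.

(* Main.v *)
Require Import Defs.
From HB Require Import structures.
From mathcomp Require Import all_boot all_order all_algebra.
From mathcomp Require Import generic_quotient ring_quotient fraction.
From mathcomp Require Import boolp constructive_ereal.

Set Implicit Arguments.
Unset Strict Implicit.
Unset Printing Implicit Defensive.

Import Order.TTheory GRing.Theory Num.Theory.

Local Open Scope ring_scope.
Local Open Scope quotient_scope.

(* Let [t] be a uniformizer and [k'/k] the residue field extension, of degree
   [d].  Sending [f] to the residue of [f / t ^+ n] embeds [I_n / I_(n+1)] as a
   [k]-subspace of [k'], so the length of [R / I_n] is the sum over [i < n] of
   the dimensions of these subspaces.  It remains to see that the subspace is
   [k'] for all large [n].  A basis of [k'] lifts to fractions [f_i / g] of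
   elements of [R] with a common denominator [g].  Since [t = a / b] in the
   quotient field, the values of [a] and [b] are consecutive integers, so every
   large integer is the value of some [h] in [R].  Taking [v h = n - v g], the
   residues of [f_i h / t ^+ n] are those of [f_i / g] times a nonzero constant,
   hence form a basis of [k']. *)

(** * Chains of submodules and the length of a quotient module *)

Section Chains.
Variables (R : comNzRingType) (M : lmodType R).
Implicit Types (A : {pred M}) (C : nat -> {pred M}).

Lemma submodule_chain_cons l A C : submod_closed A -> submodule_chain l C ->
  {subset A <= C 0%N} -> (exists2 x, x \in C 0%N & x \notin A) ->
  submodule_chain l.+1 (fun i => if i is j.+1 then C j else A).
Proof.
move=> clA [clC ltC] sA xA; split=> [[|i] il|[|i] il] //; first exact: clC.
exact: ltC.
Qed.

Lemma submodule_chain_sub l C i : submodule_chain l C -> (i <= l)%N ->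
  {subset C 0%N <= C i}.
Proof.
move=> [_ ltC]; elim: i => [_ x //|i IH il x x0].
by apply: (proj1 (ltC _ il)); apply: IH (ltnW il) _ x0.
Qed.

(** Each strict inclusion raises the rank by at least one. Monotonicity is asked only above [C 0],
    since the rank used later separates only submodules containing [I n]. *)
Lemma submodule_chain_rank (rk : {pred M} -> nat) l C : submodule_chain l C ->
  (forall A B, submod_closed A -> submod_closed B -> {subset C 0%N <= A} ->
     {subset A <= B} -> (exists2 x, x \in B & x \notin A) -> (rk A < rk B)%N) ->
  (l <= rk (C l))%N.
Proof.
move=> Cc rkS; have [clC ltC] := Cc.
suff: forall i, (i <= l)%N -> (i <= rk (C i))%N by apply.
elim=> // i IH il; apply: leq_ltn_trans (IH (ltnW il)) _.
have [sub xP] := ltC _ il; apply: rkS => //; [exact/clC/ltnW|exact: clC|].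
exact: submodule_chain_sub Cc (ltnW il).
Qed.

Lemma pi_modquotZ (N : submodClosed M) a (x : M) :
  a *: \pi_(modquot N) x = \pi_(modquot N) (a *: x).
Proof. exact: modquot_scale_pi. Qed.

(** Submodules of [M / N] correspond to submodules of [M] containing [N], so chains can be moved
    both ways. *)
Lemma has_length_modquot (N : submodClosed M) l :
  (exists2 C, submodule_chain l C & {subset N <= C 0%N}) ->
  (forall k C, submodule_chain k C -> {subset N <= C 0%N} -> (k <= l)%N) ->
  has_length (modquot N) l.
Proof.
move=> [C Cc NC] maxl; split=> [|k D [clD ltD]].
  pose D i : {pred modquot N} := fun x => repr x \in C i.
  (* The choice of representative does not matter: two of them differ by an element of [N], which
     lies in every [C i]. *)
  have piD i x : (i <= l)%N -> (\pi_(modquot N) x \in D i) = (x \in C i).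
    move=> il; have [C0 CD] := proj1 Cc _ il.
    have : repr (\pi_(modquot N) x) - x \in C i.
      apply: submodule_chain_sub Cc il _ _; apply: NC.
      have : repr (\pi_(modquot N) x) - x \in submod_pred N.
        by rewrite Quotient.idealrBE reprK.
      by [].
    set y := repr _ => yx; rewrite [LHS]/(y \in C i).
    apply/idP/idP => [yC|xC].
      have -> : x = -1 *: (y - x) + y by rewrite scaleN1r opprB subrK.
      exact: CD.
    have -> : y = 1 *: (y - x) + x by rewrite scale1r subrK.
    exact: CD.
  have [clC ltC] := Cc; exists D; split=> i il.
    have [C0 CD] := clC _ il; split=> [|a x y].
      by rewrite -(raddf0 \pi_(modquot N)) piD.
    elim/quotW: x => x; elim/quotW: y => y; rewrite !piD // => xC yC.
    by rewrite pi_modquotZ -raddfD piD //; exact: CD.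
  have [sub [x xC xNC]] := ltC _ il; split=> [y|].
    exact: sub.
  exists (\pi_(modquot N) x).
    by have := piD _ x il; rewrite xC.
  by have := piD _ x (ltnW il); rewrite (negPf xNC) => /negbT.
apply: (maxl _ (fun i => [pred x | \pi_(modquot N) x \in D i])).
  split=> i il.
    have [D0 DD] := clD _ il; split=> [|a x y xD yD]; rewrite inE.
      by rewrite raddf0.
    have -> : \pi_(modquot N) (a *: x + y) =
        a *: \pi_(modquot N) x + \pi_(modquot N) y.
      by rewrite pi_modquotZ raddfD.
    exact: DD.
  have [sub [x xD xND]] := ltD _ il; split=> [y|]; first exact: sub.
  by exists (repr x); rewrite inE reprK.
move=> x xN; rewrite inE.
have -> : \pi_(modquot N) x = 0.
  apply/eqP; rewrite -(raddf0 \pi_(modquot N)) piE /Quotient.equiv subr0.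
  exact: xN.
by case: (clD _ (leq0n k)).
Qed.

End Chains.

(** Take a subspace of maximal dimension inside [P]; adding the line of any [x] in [P] cannot
    enlarge it. *)
Lemma submod_closed_vspace (F : fieldType) (vT : vectType F) (P : {pred vT}) :
  submod_closed P -> exists U : {vspace vT}, U =i P.
Proof.
move=> [P0 PD].
pose Q n := `[< exists2 U : {vspace vT}, {subset U <= P} & \dim U = n >].
have Q0 : exists n, Q n.
  exists 0%N; apply/asboolP; exists 0%VS; last by rewrite dimv0.
  by move=> x; rewrite memv0 => /eqP->.
have Qmax n : Q n -> (n <= \dim {:vT})%N.
  by move=> /asboolP[U _ <-]; apply/dimvS/subvf.
case: (ex_maxnP Q0 Qmax) => m /asboolP[U UP Um] maxU; exists U => x.
apply/idP/idP => [/UP//|xP].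
have /maxU : Q (\dim (U + <[x]>)%VS).
  apply/asboolP; exists (U + <[x]>)%VS => // y /memv_addP[u /UP uP [z]].
  by move=> /vlineP[a ->] ->; rewrite addrC PD.
rewrite -Um => dimU; have /eqP -> : U == (U + <[x]>)%VS.
  by rewrite eqEdim addvSl.
by apply: (subvP (addvSr _ _)); exact: memv_line.
Qed.

(** * Length along a filtration whose graded pieces embed in a vector space *)

Section Filtration.
Variables (R : comNzRingType) (F : fieldType) (M : lmodType R).
Variables (vT : vectType F) (pi : R -> F).
Variables (I : nat -> submodClosed M) (lead : nat -> M -> vT).
Hypothesis pi_surj : forall c, exists a, pi a = c.
Hypothesis filt0 : forall x, x \in I 0.
Hypothesis filtS : forall n, {subset I n.+1 <= I n}.
Hypothesis lead_linear : forall n a, {in I n &, forall x y,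
  lead n (a *: x + y) = pi a *: lead n x + lead n y}.
Hypothesis lead_eq0 : forall n, {in I n, forall x,
  (lead n x == 0) = (x \in I n.+1)}.

Let filt_closed n : submod_closed (I n).
Proof. by case: (submodClosedP (I n)). Qed.

Let lead0 n : lead n 0 = 0.
Proof.
by apply/eqP; rewrite lead_eq0; case: (filt_closed n.+1) (filt_closed n) => ? _ [].
Qed.

(** The closedness of [A] is assumed under the existential so that a subspace can be chosen for
    every predicate, which makes [lsp] total. *)
Lemma lead_vspace n (A : {pred M}) : exists U : {vspace vT},
  submod_closed A ->
  forall w, w \in U <-> exists2 x, x \in A & x \in I n /\ lead n x = w.
Proof.
pose P : {pred vT} := fun w =>
  `[< exists2 x, x \in A & x \in I n /\ lead n x = w >].
have [clA|] := pselect (submod_closed A); last by exists 0%VS.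
have [A0 AD] := clA; have [I0 ID] := filt_closed n.
have [|U UP] := @submod_closed_vspace _ _ P.
  split=> [|c _ _ /asboolP[x xA [xI <-]] /asboolP[y yA [yI <-]]].
    by apply/asboolP; exists 0.
  have [a <-] := pi_surj c; apply/asboolP; exists (a *: x + y); first exact: AD.
  by split; [exact: ID|exact: lead_linear].
by exists U => _ w; rewrite UP; split=> /asboolP.
Qed.

Let lsp n A : {vspace vT} := sval (cid (lead_vspace n A)).

Let lspP n (A : {pred M}) : submod_closed A ->
  forall w, w \in lsp n A <-> exists2 x, x \in A & x \in I n /\ lead n x = w.
Proof. by rewrite /lsp; case: cid. Qed.

(* A submodule between [I n] and [M] is determined, among those containing
   it, by its spaces of leading forms of degree less than [n]. *)
Let rank_lt n (A B : {pred M}) : submod_closed A -> submod_closed B ->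
  {subset I n <= A} -> {subset A <= B} -> (exists2 x, x \in B & x \notin A) ->
  (\sum_(i < n) \dim (lsp i A) < \sum_(i < n) \dim (lsp i B))%N.
Proof.
move=> clA clB IA AB [x xB xNA]; have [_ BD] := clB; have [A0 AD] := clA.
have sub i : (lsp i A <= lsp i B)%VS.
  apply/subvP => w /(lspP _ clA)[y yA yP].
  by apply/(lspP _ clB); exists y => //; exact: AB.
rewrite ltnNge; apply: contra xNA => leBA.
(* The spaces are included termwise, so a strict inclusion in one degree would contradict the
   inequality of sums. *)
have eqAB (i : 'I_n) : lsp i A = lsp i B.
  apply/eqP; rewrite eqEdim sub /= leqNgt; apply/negP => ltAB.
  move: leBA; rewrite leqNgt => /negP; apply.
  rewrite (bigD1 i) //= [ltnRHS](bigD1 i) //= -addSn leq_add //.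
  by apply: leq_sum => j _; exact/dimvS.
(* Successive approximation: correcting [y] by an element of [A] with the leading form of [x - y]
   raises the degree, until the difference falls in [I n], hence in [A]. *)
suff: forall m, (m <= n)%N -> exists2 y, y \in A & x - y \in I m.
  case/(_ n (leqnn n)) => y yA /IA xyA.
  have -> : x = 1 *: (x - y) + y by rewrite scale1r subrK.
  exact: AD.
elim=> [_|m IHm mn]; first by exists 0.
have [y yA yI] := IHm (ltnW mn).
have [Im0 ImD] := filt_closed m.
have : lead m (x - y) \in lsp m B.
  apply/(lspP _ clB); exists (x - y) => //.
  by rewrite addrC -scaleN1r BD // AB.
have /= <- := eqAB (Ordinal mn) => /(lspP _ clA)[z zA [zI leadz]].
exists (y + z); first by rewrite -[y]scale1r AD.
have -> : x - (y + z) = -1 *: z + (x - y).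
  by rewrite scaleN1r opprD addrA addrC.
rewrite -lead_eq0 ?ImD // lead_linear // leadz.
have := lead_linear (-1) zI zI; rewrite scaleN1r addNr lead0 leadz => <-.
by [].
Qed.

(** The chain is extended downwards from [I n] to [I n.+1], one basis vector of the space of leading
    forms at a time. *)
Let filt_chain n : exists2 C : nat -> {pred M},
  submodule_chain (\sum_(i < n) \dim (lsp i predT)) C & C 0%N =i I n.
Proof.
have clT : submod_closed (predT : {pred M}) by [].
elim: n => [|n [C Cc C0]].
  by exists (fun=> predT : {pred M}) => [|x]; rewrite ?big_ord0 ?filt0.
pose J X : {pred M} := [pred x | (x \in I n) && (lead n x \in <<X>>%VS)].
have clJ X : submod_closed (J X).
  have [I0 ID] := filt_closed n; split=> [|a x y].
    by rewrite inE I0 lead0 mem0v.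
  rewrite !inE => /andP[xI xX] /andP[yI yX].
  by rewrite ID // lead_linear // rpredD // rpredZ.
(* Dropping the head of a free family shrinks [J] strictly, as that vector is a leading form outside
   the span of the tail. [J] is [I n] for a full basis and [I n.+1] for the empty family. *)
suff step X l D : free X -> (<<X>> <= lsp n predT)%VS ->
    submodule_chain l D -> D 0%N =i J X ->
    exists2 D', submodule_chain (l + size X) D' & D' 0%N =i I n.+1.
  rewrite big_ord_recr /= -(size_tuple (vbasis (lsp n predT))).
  apply: step Cc _; first exact: basis_free (vbasisP _).
    by rewrite (span_basis (vbasisP _)).
  move=> x; rewrite C0 inE (span_basis (vbasisP _)).
  by apply/idP/andP => [xI|[]//]; split=> //; apply/lspP => //; exists x.
elim: X l D => [|w X IHX] l D.
  move=> _ _ Dc D0; exists D; first by rewrite addn0.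
  move=> x; rewrite D0 inE span_nil memv0; apply/andP/idP => [[xI]|xI].
    by rewrite lead_eq0.
  by have /= xn := filtS xI; rewrite lead_eq0.
rewrite free_cons span_cons => /andP[wX freeX] sub Dc D0.
rewrite addnS -addSn; apply: (IHX _ (fun i => if i is j.+1 then D j else J X)).
- exact: freeX.
- by apply: subv_trans sub; exact: addvSr.
- apply: submodule_chain_cons => //.
    move=> x; rewrite D0 !inE span_cons => /andP[-> xX] /=.
    by apply: (subvP (addvSr _ _)).
  have /(lspP _ clT)[x _ [xI leadx]] : w \in lsp n predT.
    by apply: (subvP sub); apply: (subvP (addvSl _ _)); exact: memv_line.
  exists x; last by rewrite inE xI leadx.
  rewrite D0 inE xI leadx span_cons /=.
  by apply: (subvP (addvSl _ _)); exact: memv_line.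
- by [].
Qed.

(** Here [r i] is the dimension of the leading forms of degree [i]: [filt_chain] attains the sum and
    [rank_lt] bounds every chain by it. *)
Lemma filtration_length : exists r : nat -> nat,
  (forall n, has_length (modquot (I n)) (\sum_(i < n) r i)) /\
  (forall n, (forall w, exists2 x, x \in I n & lead n x = w) ->
     r n = \dim {:vT}).
Proof.
exists (fun i => \dim (lsp i predT)); split=> n.
  apply: has_length_modquot.
    by have [C Cc C0] := filt_chain n; exists C => // x; rewrite C0.
  move=> k C Cc C0; have [clC _] := Cc.
  apply: (leq_trans (submodule_chain_rank (rk := fun A =>
    (\sum_(i < n) \dim (lsp i A))%N) Cc _)).
    move=> A B clA clB CA; apply: rank_lt => // x xI.
    exact/CA/C0.
  apply: leq_sum => i _; apply/dimvS/subvP => w.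
  move=> /(lspP _ (clC _ (leqnn k)))[x _ xP].
  by apply/lspP => //; exists x.
move=> lead_surj; congr (\dim _); apply/vspaceP => w; rewrite memvf.
by apply/lspP => //; have [x xI xw] := lead_surj w; exists x.
Qed.

End Filtration.

Lemma fraction_divE (R : idomainType) (x : {fraction R}) :
  exists a b : R, b != 0 /\ x = a%:F / b%:F.
Proof.
elim/quotW: x => r; exists (\n_r), (\d_r); split; first exact: denom_ratioP.
unlock FracField.tofrac; rewrite -[X in _ * X]FracField.pi_inv -[RHS]FracField.pi_mul.
rewrite /FracField.invf /FracField.mulf !numden_Ratio ?oner_neq0 ?denom_ratioP //.
by rewrite mulr1 mul1r Ratio_numden.
Qed.

(** * Values and residues for a discrete valuation *)

Section DiscreteValuation.
Variables (K : fieldType) (v : discreteValuation K).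

Lemma dval_fin x : x != 0 -> exists z : int, v x = z%:E.
Proof.
move=> x0; have := dvalM v x x^-1; rewrite mulfV // dval1.
by case: (v x) => [z| |] //; [exists z|case: (v x^-1)].
Qed.

Lemma dval_neq0 x (z : int) : v x = z%:E -> x != 0.
Proof. by move=> vx; apply/eqP => /(dval_eqy v); rewrite vx. Qed.

Lemma dvalV x (z : int) : v x = z%:E -> v x^-1 = (- z)%:E.
Proof.
move=> vx; have x0 := dval_neq0 vx.
have [w vw] : exists w : int, v x^-1 = w%:E by apply: dval_fin; rewrite invr_eq0.
have := dvalM v x x^-1; rewrite mulfV // dval1 vx vw => -[/esym/eqP].
by rewrite addrC addr_eq0 => /eqP->.
Qed.

Lemma dvalX x (z : int) n : v x = z%:E -> v (x ^+ n) = (z *+ n)%:E.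
Proof.
by move=> vx; elim: n => [|n IH]; rewrite ?dval1 // exprS dvalM vx IH mulrS.
Qed.

Lemma dval_divX t x n : v t = 1%:E ->
  (v (x / t ^+ n)%R = v x - (n%:Z)%:E)%E.
Proof.
by move=> vt; rewrite dvalM (dvalV (dvalX n vt)) EFinN natz.
Qed.

(* Equal to [0] outside of the valuation ring. *)
Definition vres (x : K) : {ideal_quot (valmax v)} :=
  oapp (\pi_{ideal_quot (valmax v)}) 0 (insub x).

Lemma vres_val (x : valring v) : vres (val x) = \pi x.
Proof. by rewrite /vres valK. Qed.

Lemma vresD : {in valring_pred v &, {morph vres : x y / x + y}}.
Proof.
move=> x y xV yV; rewrite -[x](SubK (valring v) xV) -[y](SubK (valring v) yV).
by rewrite -raddfD !vres_val raddfD.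
Qed.

Lemma vresM : {in valring_pred v &, {morph vres : x y / x * y}}.
Proof.
move=> x y xV yV; rewrite -[x](SubK (valring v) xV) -[y](SubK (valring v) yV).
by rewrite -rmorphM !vres_val rmorphM.
Qed.

Lemma vres_eq0 : {in valring_pred v, forall x, (vres x == 0) = (0 < v x)%E}.
Proof.
move=> x xV; rewrite -[x](SubK (valring v) xV) vres_val.
by rewrite -(raddf0 \pi_{ideal_quot (valmax v)}) piE /Quotient.equiv subr0.
Qed.

Lemma vres_surj y : exists2 x, x \in valring_pred v & vres x = y.
Proof.
elim/quotW: y => y; exists (val y); [exact: valP|exact: vres_val].
Qed.

End DiscreteValuation.

(** * Leading forms of the valuation ideals of a dominated local domain *)

Section Dominating.
Variables (R : localDomain) (v : dominatingValuation R).

Lemma vres_tofrac (f : R) : vres v f%:F = resmap v (\pi_(residue R) f).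
Proof. by rewrite resmap_pi -vres_val. Qed.

Lemma dval_tofrac (f : R) : f != 0 -> exists n : nat, v f%:F = (n%:Z)%:E.
Proof.
move=> f0; have [|[n|n] vf] := @dval_fin _ v f%:F; first by rewrite tofrac_eq0.
  by exists n.
by have := dominating_sub v f; rewrite unfold_in /valring_pred vf.
Qed.

Lemma dval_semigroup : exists N : nat, forall n, (N <= n)%N ->
  exists f : R, v f%:F = (n%:Z)%:E.
Proof.
have [t vt] := dval_surj v 1; have [a [b [b0 tE]]] := fraction_divE t.
have [p vb] := dval_tofrac b0.
have va : v a%:F = (p.+1%:Z)%:E.
  have -> : a%:F = t * b%:F by rewrite tE divfK ?tofrac_eq0.
  by rewrite dvalM vt vb.
exists (p * p)%N => n pn.
(* Write [n = q * p + r] with [r < p]; then [p * p <= n] gives [r <= q], and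
   [n = (q - r) * p + r * (p + 1)]. If [p = 0], then [a] has value 1 and its powers suffice. *)
have [i [j ->]] : exists i j, n = (p * i + p.+1 * j)%N.
  case: p pn {va vb} => [|p] pn; first by exists 0%N, n; rewrite mul1n.
  have rp : (n %% p.+1 <= n %/ p.+1)%N.
    by rewrite (leq_trans (ltnW (ltn_pmod n (ltn0Sn p)))) // leq_divRL.
  exists (n %/ p.+1 - n %% p.+1)%N, (n %% p.+1)%N.
  rewrite [X in (_ + X)%N]mulSn addnCA -mulnDr subnK // mulnC addnC.
  exact: divn_eq.
exists (b ^+ i * a ^+ j); rewrite tofracM !tofracXn dvalM.
have EX z k : ((z *+ k)%:E = (z * k%:Z)%:E :> \bar int) by rewrite -mulr_natr natz.
by rewrite (dvalX i vb) (dvalX j va) !EX -EFinD PoszD !PoszM.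
Qed.

Lemma common_denominator (s : seq (vresidue v)) : exists2 g : R, g != 0 &
  forall w, w \in s -> exists2 f : R, f%:F / g%:F \in valring_pred v &
    vres v (f%:F / g%:F) = w.
Proof.
elim: s => [|w s [g g0 IHs]]; first by exists 1; rewrite ?oner_neq0.
have [x xV <-] := vres_surj w; have [a [b [b0 xE]]] := fraction_divE x.
exists (g * b); first by rewrite mulf_neq0.
have gF : g%:F != 0 by rewrite tofrac_eq0.
have bF : b%:F != 0 by rewrite tofrac_eq0.
move=> u; rewrite inE => /predU1P[->|/IHs[f fV fu]].
  by exists (g * a); rewrite !tofracM invfM mulrACA mulfV // mul1r -xE.
by exists (f * b); rewrite !tofracM invfM mulrACA mulfV // mulr1.
Qed.

Section LeadingForm.
Variables (d : nat) (phi : vresidue v -> 'rV[residue R]_d).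
Hypotheses (phi_linear : linear phi) (phi_bij : bijective phi).
Variables (t : {fraction R}) (vt : v t = 1%:E).

Let lead n (f : R) := phi (vres v (f%:F / t ^+ n)).

Let valideal_divX n (f : R) :
  (f \in valideal v n) = (f%:F / t ^+ n \in valring_pred v).
Proof.
by rewrite !unfold_in /valring_pred /valideal dval_divX // sube_ge0.
Qed.

Let phi0 : phi 0 = 0.
Proof. by have := phi_linear (-1) 0 0; rewrite !scaleN1r !addNr. Qed.

(** The denominator [s] is arbitrary because both [t ^+ n] and the common denominator [g] are
    needed. *)
Let fracD a (f g : R) (s : {fraction R}) :
    f%:F / s \in valring_pred v -> g%:F / s \in valring_pred v ->
  phi (vres v ((a * f + g)%:F / s)) =
    \pi_(residue R) a *: phi (vres v (f%:F / s)) + phi (vres v (g%:F / s)).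
Proof.
move=> fV gV; rewrite -phi_linear; congr phi.
rewrite tofracD tofracM mulrDl -mulrA.
have aV : a%:F \in valring_pred v := dominating_sub v a.
have afV : a%:F * (f%:F / s) \in valring_pred v by rewrite rpredM.
by rewrite (vresD afV gV) (vresM aV fV) vres_tofrac.
Qed.

Let lead_linear n a (f g : R) : f \in valideal v n -> g \in valideal v n ->
  lead n (a * f + g) = \pi_(residue R) a *: lead n f + lead n g.
Proof. by rewrite !valideal_divX => fV gV; exact: fracD. Qed.

Let lead_eq0 n (f : R) :
  f \in valideal v n -> (lead n f == 0) = (f \in valideal v n.+1).
Proof.
rewrite valideal_divX => fV.
rewrite /lead -phi0 (inj_eq (bij_inj phi_bij)) (vres_eq0 fV) (dval_divX _ n vt).
rewrite sube_gt0 unfold_in /valideal.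
(* Values are integers, so exceeding [n] means being at least [n + 1]. *)
by case: (v f%:F) => [z| |] //; rewrite ?ltry ?leey // lte_fin lee_fin -lez1D.
Qed.

Let lead_surj : exists N : nat, forall n, (N <= n)%N ->
  forall w, exists2 f : R, f \in valideal v n & lead n f = w.
Proof.
have [psi phiK psiK] := phi_bij.
have [g g0 gP] := common_denominator [seq psi (delta_mx 0 i) | i : 'I_d].
have gV w : exists2 f : R, f%:F / g%:F \in valring_pred v &
    vres v (f%:F / g%:F) = psi w.
  (* The vectors realized with denominator [g] form a subspace; it contains the standard basis,
     hence is everything. *)
  pose P : {pred 'rV[residue R]_d} := fun w =>
    `[< exists2 f : R, f%:F / g%:F \in valring_pred v &
        phi (vres v (f%:F / g%:F)) = w >].
  suff /asboolP[f fV fw] : w \in P by exists f => //; rewrite -fw phiK.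
  have [P0 PD] : submod_closed P.
    split=> [|c _ _ /asboolP[f1 f1V <-] /asboolP[f2 f2V <-]].
      apply/asboolP; exists 0; rewrite raddf0 mul0r ?rpred0 //.
      by apply/eqP; rewrite -phi0 (inj_eq (bij_inj phi_bij)) vres_eq0 ?dval0 ?rpred0.
    elim/quotW: c => a; apply/asboolP; exists (a * f1 + f2).
      have aV : a%:F \in valring_pred v := dominating_sub v a.
      by rewrite tofracD tofracM mulrDl -mulrA rpredD // rpredM.
    by rewrite fracD.
  rewrite [w]row_sum_delta; elim/big_ind: _ => // [x y xP yP|i _].
    by rewrite -[x]scale1r PD.
  rewrite -[_ *: _]addr0 PD //; apply/asboolP.
  have [|f fV fw] := gP (psi (delta_mx 0 i)); first exact: map_f (mem_enum _ i).
  by exists f => //; rewrite fw psiK.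
have [N NP] := dval_semigroup; have [e ve] := dval_tofrac g0.
(* The shift by [e = v g] ensures [N <= n - e], so that [n - e] is a value on [R]. *)
exists (N + e)%N => n Nn w.
have [|h vh] := NP (n - e)%N.
  by rewrite leq_subRL ?(leq_trans _ Nn) ?leq_addl // addnC.
pose u : {fraction R} := (g * h)%:F / t ^+ n.
have vu : v u = 0%E.
  rewrite dval_divX // tofracM dvalM ve vh -EFinD -PoszD subnKC.
    by rewrite subrr.
  by rewrite (leq_trans _ Nn) ?leq_addl.
have uV : u \in valring_pred v by rewrite unfold_in /valring_pred vu.
have u0 : vres v u != 0 by rewrite vres_eq0 // vu ltxx.
(* Since [u] has value 0 its residue is invertible; dividing by it beforehand cancels the factor [u]
   in [fhE]. *)
have [f fV fw] := gV (phi (psi w / (vres v u : vresidue v))).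
have fhE : (f * h)%:F / t ^+ n = f%:F / g%:F * u.
  rewrite /u !tofracM -!mulrA; congr (_ * _).
  by rewrite mulKf ?tofrac_eq0.
exists (f * h); first by rewrite valideal_divX fhE rpredM.
by rewrite /lead fhE vresM // fw phiK (@divfK (vresidue v)) ?psiK.
Qed.

Lemma length_valideal : exists r : nat -> nat,
  (forall n, has_length (modquot (valideal v n)) (\sum_(i < n) r i)) /\
  exists N : nat, forall n, (N <= n)%N -> r n = d.
Proof.
have pi_surj (c : residue R) : exists a : R, \pi_(residue R) a = c.
  by exists (repr c); rewrite reprK.
have filt0 (f : R^o) : f \in valideal v 0 by exact: dominating_sub.
have filtS n : {subset valideal v n.+1 <= valideal v n}.
  move=> f; rewrite !unfold_in /valideal; apply: le_trans.
  by rewrite lee_fin lez_nat.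
have [r [lenr rd]] := @filtration_length R (residue R) R^o 'rV_d
  \pi_(residue R) (fun n => valideal v n) lead pi_surj filt0 filtS
  lead_linear lead_eq0.
exists r; split=> //; have [N surj] := lead_surj; exists N => n /surj nsurj.
by rewrite rd // dimvf /dim /= mul1n.
Qed.

End LeadingForm.

End Dominating.

Theorem theorem1p1 (R : localDomain) (v : dominatingValuation R)
    (valg : algebraic_valuation v)
    (vfin : exists d : nat, residue_degree v d) :
  exists c b : int,
    (exists2 d : nat, residue_degree v d & c = d%:Z) /\
    exists N : nat, forall n : nat, (N <= n)%N ->
      exists2 l : nat, has_length (modquot (valideal v n)) l
                     & l%:Z = c * n%:Z + b.
Proof.
have [d dP] := vfin; have [[phi phi_linear phi_bij]] := dP.
have [t vt] := dval_surj v 1.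
have [r [lenr [N rN]]] := length_valideal phi_linear phi_bij vt.
(* From [N] on each degree contributes exactly [d]; the constant term corrects for the degrees below
   [N]. *)
exists d%:Z, ((\sum_(i < N) r i)%N%:Z - d%:Z * N%:Z); split; first by exists d.
exists N => n Nn; exists (\sum_(i < n) r i)%N; first exact: lenr.
have -> : (\sum_(i < n) r i = \sum_(i < N) r i + d * (n - N))%N.
  rewrite -!(big_mkord xpredT r) (big_cat_nat (n := N)) //=; congr addn.
  rewrite (eq_big_nat _ _ (F2 := fun=> d)) => [|i /andP[Ni _]]; last exact: rN.
  by rewrite sum_nat_const_nat mulnC.
by rewrite PoszD PoszM -subzn // mulrBr addrCA.
Qed.
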